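(* Let $m\ge 1$ be an integer, let $0\le k_2\le k_1\le 1$ be integers, and let $\alpha_i,\alpha_{i,0},\beta_i,\beta_{i,0}$ ($i=1,2$) be complex numbers such that for each $i$ at least one of $\alpha_i,\beta_i$ is nonzero. If the scalar boundary conditions $$\alpha_i y^{(k_i)}(0)+\alpha_{i,0}y(0)+\beta_i y^{(k_i)}(1)+\beta_{i,0}y(1)=0,\quad i=1,2,$$ for functions $y:[0,1]\to\mathbb{C}$ are regular, then the vector boundary conditions $$\alpha_i \mathbf{y}^{(k_i)}(0)+\alpha_{i,0}\mathbf{y}(0)+\beta_i \mathbf{y}^{(k_i)}(1)+\beta_{i,0}\mathbf{y}(1)=0,\quad i=1,2,$$ for functions $\mathbf{y}:[0,1]\to\mathbb{C}^m$ are also regular.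
   Context: Let $\omega_1,\omega_2$ be the two distinct square roots of $-1$. The scalar boundary conditions are called regular if the numbers $\theta_{-1}$ and $\theta_1$ defined by the identity (in the variable $s$) $$\frac{\theta_{-1}}{s}+\theta_0+\theta_1 s=\det\begin{bmatrix}(\alpha_1+s\beta_1)\omega_1^{k_1} & (\alpha_1+\frac1s\beta_1)\omega_2^{k_1}\\ (\alpha_2+s\beta_2)\omega_1^{k_2} & (\alpha_2+\frac1s\beta_2)\omega_2^{k_2}\end{bmatrix}$$ are both different from zero. The vector boundary conditions are called regular if the numbers $\Theta_{-m}$ and $\Theta_m$ defined by the identity $$\Theta_{-m}s^{-m}+\Theta_{-m+1}s^{-m+1}+\dots+\Theta_m s^m=\det\begin{bmatrix}(\alpha_1+s\beta_1)\omega_1^{k_1}I & (\alpha_1+\frac1s\beta_1)\omega_2^{k_1}I\\ (\alpha_2+s\beta_2)\omega_1^{k_2}I & (\alpha_2+\frac1s\beta_2)\omega_2^{k_2}I\end{bmatrix}$$ are both different from zero, where $I$ is the $m\times m$ identity matrix (so the matrix is $2m\times 2m$). *)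

(* Defs.v *)
From HB Require Import structures.
From mathcomp Require Export all_boot all_order all_algebra.
From mathcomp Require Export reals.
From mathcomp Require Export complex.

Set Implicit Arguments.
Unset Strict Implicit.
Unset Printing Implicit Defensive.

Import Order.TTheory GRing.Theory Num.Theory.
Local Open Scope ring_scope.

(* The data (k, alpha, alpha_0, beta, beta_0) of one two-point condition
     alpha y^(k)(0) + alpha_0 y(0) + beta y^(k)(1) + beta_0 y(1) = 0.
   The coefficients being scalars, the same data describe a condition on
   functions y : [0,1] -> C and one on functions y : [0,1] -> C^m. *)
Record boundary_condition (R : realType) := BoundaryCondition {
  bc_order  : nat;
  bc_alpha  : R[i];
  bc_alpha0 : R[i];
  bc_beta   : R[i];
  bc_beta0  : R[i]
}.

Definition bc_entry (R : realType) (U : boundary_condition R) (s w : R[i]) :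
    R[i] :=
  (bc_alpha U + s * bc_beta U) * w ^+ bc_order U.

Definition scalar_bc_mx (R : realType) (U1 U2 : boundary_condition R)
    (w1 w2 s : R[i]) : 'M[R[i]]_2 :=
  \matrix_(i < 2, j < 2)
    bc_entry (if i == 0 then U1 else U2)
             (if j == 0 then s else 1 / s)
             (if j == 0 then w1 else w2).

Definition vector_bc_mx (R : realType) (m : nat)
    (U1 U2 : boundary_condition R) (w1 w2 s : R[i]) : 'M[R[i]]_(m + m) :=
  block_mx (bc_entry U1 s w1 *: 1%:M) (bc_entry U1 (1 / s) w2 *: 1%:M)
           (bc_entry U2 s w1 *: 1%:M) (bc_entry U2 (1 / s) w2 *: 1%:M).

(* In both definitions below the identity in s determines the coefficients
   uniquely: multiplied by a power of s, it is an equality of polynomials at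
   infinitely many points. *)
Definition scalar_regular (R : realType) (U1 U2 : boundary_condition R)
    (w1 w2 : R[i]) : Prop :=
  exists theta_m1 theta_0 theta_1 : R[i],
    [/\ forall s : R[i], s != 0 ->
          theta_m1 / s + theta_0 + theta_1 * s
          = \det (scalar_bc_mx U1 U2 w1 w2 s),
        theta_m1 != 0 & theta_1 != 0].

(* Theta is indexed by int, as a Laurent coefficient sequence; only the
   indices j - m with 0 <= j <= 2m, i.e. those from -m to m, are used. *)
Definition vector_regular (R : realType) (m : nat)
    (U1 U2 : boundary_condition R) (w1 w2 : R[i]) : Prop :=
  exists Theta : int -> R[i],
    [/\ forall s : R[i], s != 0 ->
          \sum_(j < (2 * m)%N.+1) Theta (j%:Z - m%:Z) * s ^ (j%:Z - m%:Z)
          = \det (vector_bc_mx m U1 U2 w1 w2 s),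
        Theta (- m%:Z) != 0 & Theta m%:Z != 0].

(* Main.v *)
(** The vector determinant has scalar blocks, hence equals the m-th power of the
    scalar one, i.e. [(p.[s] / s) ^ m] with [p = theta_m1 + theta_0 X + theta_1 X^2].
    So the [Theta]s are the coefficients of [p ^ m], whose extreme ones are
    [theta_m1 ^ m] and [theta_1 ^ m]. *)
Require Import Defs.
From mathcomp Require Import ring zify.
Import GRing.Theory.
Local Open Scope ring_scope.

Lemma det_block_scalar_mx (R : comNzRingType) (m : nat) (a b c d : R) :
  \det (block_mx a%:M b%:M c%:M d%:M : 'M_(m + m)) = (a * d - b * c) ^+ m.
Proof.
(* Over [R[X]], with [d] replaced by the regular element [X + d], right
   multiplication by [X + d, 0; - c, 1] makes the matrix block triangular. *)
pose e : {poly R} := 'X + d%:P.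
have e_monic : e \is monic by rewrite monicXaddC.
pose A : 'M[{poly R}]_(m + m) := block_mx a%:P%:M b%:P%:M c%:P%:M e%:M.
have detA : \det A = (a%:P * e - b%:P * c%:P) ^+ m.
  (* The triangular factor has determinant [e ^+ m], which is monic and so can be cancelled. *)
  apply: (monic_rreg (monic_exp m e_monic)).
  transitivity (\det (A *m block_mx e%:M 0 (- c%:P)%:M 1%:M)).
    by rewrite det_mulmx det_lblock det1 mulr1 det_scalar.
  rewrite mulmx_block !mulmx0 !mulmx1 !add0r -!scalar_mxM -!raddfD /=.
  have -> : c%:P * e + e * - c%:P = 0 :> {poly R} by ring.
  by rewrite raddf0 det_ublock !det_scalar mulrN.
(* Evaluating at [X = 0] sends [e] back to [d]. *)
have := congr1 (horner_eval (0 : R)) detA.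
rewrite -det_map_mx map_block_mx !map_scalar_mx rmorphXn /= !horner_evalE.
by rewrite !hornerE.
Qed.

Lemma det_vector_bc_mx (R : realType) (m : nat) (U1 U2 : boundary_condition R)
    (w1 w2 s : R[i]) :
  \det (vector_bc_mx m U1 U2 w1 w2 s)
    = \det (scalar_bc_mx U1 U2 w1 w2 s) ^+ m.
Proof.
rewrite /vector_bc_mx !scalemx1 det_block_scalar_mx; congr (_ ^+ m).
rewrite (expand_det_row _ 0) !big_ord_recl big_ord0 /cofactor !det_mx11 !mxE /=.
by ring.
Qed.

Theorem theorem1 (R : realType) (w1 w2 : R[i])
    (hw1 : w1 ^+ 2 = -1) (hw2 : w2 ^+ 2 = -1) (hw : w1 != w2)
    (m : nat) (hm : (1 <= m)%N) (k1 k2 : nat)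
    (hk21 : (k2 <= k1)%N) (hk1 : (k1 <= 1)%N)
    (alpha1 alpha10 beta1 beta10 alpha2 alpha20 beta2 beta20 : R[i])
    (hab1 : alpha1 != 0 \/ beta1 != 0)
    (hab2 : alpha2 != 0 \/ beta2 != 0) :
  let U1 := BoundaryCondition k1 alpha1 alpha10 beta1 beta10 in
  let U2 := BoundaryCondition k2 alpha2 alpha20 beta2 beta20 in
  scalar_regular U1 U2 w1 w2 -> vector_regular m U1 U2 w1 w2.
Proof.
move=> U1 U2 [t_m1 [t_0 [t_1 [det_s tm1_n0 t1_n0]]]].
pose p := Poly [:: t_m1; t_0; t_1].
(* Since [t_1 != 0], [Poly] strips no trailing zero, so [p] has degree exactly 2. *)
have p_seq : p = [:: t_m1; t_0; t_1] :> seq _ by rewrite (PolyK (c := 0)).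
have size_pm : size (p ^+ m) = (2 * m).+1.
  rewrite -(prednK (n := size (p ^+ m))) ?size_exp ?p_seq //.
  by rewrite size_poly_gt0 expf_neq0 // -size_poly_gt0 p_seq.
(* Dividing [p ^+ m] by [s ^+ m] lowers exponents by [m], so [Theta k] is the coefficient of
   [X^(k + m)]. The absolute value only casts to [nat]: [k + m >= 0] at the indices used. *)
exists (fun k => (p ^+ m)`_`|(k + m%:Z)%R|); split=> [s s_n0||].
- rewrite det_vector_bc_mx -det_s //.
  have -> : t_m1 / s + t_0 + t_1 * s = p.[s] / s.
    by rewrite horner_Poly /=; field.
  rewrite expr_div_n -horner_exp horner_coef size_pm mulr_suml.
  by apply: eq_bigr => j _; rewrite subrK expfzDr // -mulrA -exprnN.
- by rewrite addNr -horner_coef0 horner_exp horner_coef0 p_seq expf_neq0.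
have -> : `|(m%:Z + m%:Z)%R|%N = (size (p ^+ m)).-1 by rewrite size_pm; lia.
by rewrite -lead_coefE lead_coef_exp lead_coefE p_seq expf_neq0.
Qed.
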